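(* The category $\mathcal{K}_{2^{\mathbb{N}}}$, whose objects are the simplicial $\mathrm{Cu}$-semigroups $\overline{\mathbb{N}}^r$ ($r\ge1$) and whose morphisms are the order-embeddings $\alpha\colon\overline{\mathbb{N}}^r\to\overline{\mathbb{N}}^t$ such that $\alpha(1)=1$, where $1$ denotes the constant tuple $(1,\ldots,1)$, is a (Cuntz) Fraïssé category.
   Context: **$\mathrm{Cu}$-semigroups.** For $x,y$ in a partially ordered set, $x\ll y$ means: for every increasing sequence $(z_n)_n$ having a supremum with $y\le\sup_n z_n$, there is $n$ with $x\le z_n$. A $\mathrm{Cu}$-semigroup is a positively ordered (commutative) monoid $S$ such that (O1) every increasing sequence has a supremum; (O2) every element is the supremum of a $\ll$-increasing sequence; (O3) $x'\ll x$ and $y'\ll y$ imply $x'+y'\ll x+y$; (O4) $\sup_n(x_n+y_n)=\sup_n x_n+\sup_n y_n$ for increasing sequences. A $\mathrm{Cu}$-morphism is a monoid morphism preserving the order, the relation $\ll$, and suprema of increasing sequences. $\mathrm{Cu}$ denotes the resulting category. An order-embedding between $\mathrm{Cu}$-semigroups always means a $\mathrm{Cu}$-morphism $\alpha$ such that $\alpha(x)\le\alpha(y)$ implies $x\le y$. $S$ is countably-based if there is a countable subset $B\subseteq S$ such that every element of $S$ is the supremum of a $\ll$-increasing sequence in $B$. $\overline{\mathbb{N}}=\{0,1,2,\ldots,\infty\}$ and $\overline{\mathbb{N}}^r$ carries componentwise order and addition. **Finite-set comparison.** For $\mathrm{Cu}$-morphisms $\alpha,\beta\colon S\to T$ and a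 finite set $F\subseteq S$, write $\alpha\simeq_F\beta$ if $\alpha(x')\le\beta(x)$ and $\beta(x')\le\alpha(x)$ for all $x',x\in F$ with $x'\ll x$. **Fraïssé categories.** A subcategory $\mathfrak{c}$ of $\mathrm{Cu}$ is a (Cuntz) Fraïssé category if: - (JEP) for any $A_1,A_2\in\mathfrak{c}$ there is $B\in\mathfrak{c}$ with $\mathrm{Hom}_{\mathfrak{c}}(A_1,B)$ and $\mathrm{Hom}_{\mathfrak{c}}(A_2,B)$ nonempty; - (NAP) for any $\mathfrak{c}$-morphisms $\alpha_1\colon A\to B_1$, $\alpha_2\colon A\to B_2$ and any finite $F\subseteq A$, there are $C\in\mathfrak{c}$ and $\mathfrak{c}$-morphisms $\beta_1\colon B_1\to C$, $\beta_2\colon B_2\to C$ with $\beta_1\circ\alpha_1\simeq_F\beta_2\circ\alpha_2$; - (SEP) there is a subcategory $\mathfrak{s}\subseteq\mathfrak{c}$ whose objects are countably-based, whose set of morphisms is countable, such that every $A\in\mathfrak{c}$ admits a $\mathfrak{c}$-morphism to some $S\in\mathfrak{s}$, and such that for any $\mathfrak{c}$-morphism $\sigma\colon S\to A$ with $S\in\mathfrak{s}$ and any finite $F\subseteq S$ there are $T\in\mathfrak{s}$, $\alpha\in\mathrm{Hom}_{\mathfrak{c}}(A,T)$, $\tau\in\mathrm{Hom}_{\mathfrak{s}}(S,T)$ with $\alpha\circ\sigma\simeq_F\tau$. *)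

(* Defs.v *)
From HB Require Import structures.
From mathcomp Require Import all_boot all_order ssralg.
From mathcomp Require Import boolp classical_sets functions cardinality.

Set Implicit Arguments.
Unset Strict Implicit.
Unset Printing Implicit Defensive.

Import Order.TTheory GRing.Theory.

Local Open Scope classical_set_scope.
Local Open Scope order_scope.
Local Open Scope ring_scope.

Fact cu_display : Order.disp_t. Proof. exact. Qed.

(* ssrnum is deliberately not imported: its POrderedZmodule would prevent the
   declaration of the more general structure below. *)
#[short(type="porderNmodType")]
HB.structure Definition POrderedNmodule :=
  { S of Order.POrder cu_display S & GRing.Nmodule S }.

Definition increasing {S : porderType cu_display} (u : nat -> S) : Prop :=
  {homo u : m n / (m <= n)%N >-> m <= n}.

Definition is_sup {S : porderType cu_display} (u : nat -> S) (s : S) : Prop :=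
  supremums (range u) s.

Definition way_below {S : porderType cu_display} (x y : S) : Prop :=
  forall (z : nat -> S) (s : S),
    increasing z -> is_sup z s -> y <= s -> exists n, x <= z n.

Notation "x ≪ y" := (way_below x y) (at level 70) : ring_scope.

HB.mixin Record isCuSemigroup S of POrderedNmodule S := {
  cu_ge0 : forall x : S, 0 <= x;
  cu_leD2r : forall x y z : S, x <= y -> x + z <= y + z;
  cu_O1 : forall u : nat -> S, increasing u -> exists s, is_sup u s;
  cu_O2 : forall x : S,
    exists u : nat -> S, (forall n, u n ≪ u n.+1) /\ is_sup u x;
  cu_O3 : forall x' x y' y : S, x' ≪ x -> y' ≪ y -> x' + y' ≪ x + y;
  cu_O4 : forall (u v : nat -> S) (s t : S),
    increasing u -> increasing v -> is_sup u s -> is_sup v t ->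
    is_sup (fun n => u n + v n) (s + t)
}.

#[short(type="cuSemigroupType")]
HB.structure Definition CuSemigroup :=
  { S of isCuSemigroup S & POrderedNmodule S }.

Definition countably_based (S : cuSemigroupType) : Prop :=
  exists2 B : set S, countable B &
    forall x : S, exists u : nat -> S,
      [/\ forall n, B (u n), forall n, u n ≪ u n.+1 & is_sup u x].

Record cuMorphism (S T : cuSemigroupType) := CuMorphism {
  cu_fun :> S -> T;
  cu_fun_nmod : nmod_morphism cu_fun;
  cu_fun_le : {homo cu_fun : x y / x <= y};
  cu_fun_wb : forall x y, x ≪ y -> cu_fun x ≪ cu_fun y;
  cu_fun_sup : forall (u : nat -> S) (s : S),
    increasing u -> is_sup u s -> is_sup (fun n => cu_fun (u n)) (cu_fun s)
}.

Definition order_embedding (S T : cuSemigroupType) (a : cuMorphism S T) : Prop :=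
  forall x y, a x <= a y -> x <= y.

Definition cu_id (S : cuSemigroupType) : cuMorphism S S.
Proof. by exists id. Defined.

Definition cu_comp (S T U : cuSemigroupType)
  (b : cuMorphism T U) (a : cuMorphism S T) : cuMorphism S U.
Proof.
exists (b \o a).
- by split=> [|x y] /=; rewrite ?(cu_fun_nmod a).1 ?(cu_fun_nmod b).1
    ?(cu_fun_nmod a).2 ?(cu_fun_nmod b).2.
- by move=> x y xy; do 2! apply: cu_fun_le.
- by move=> x y xy; do 2! apply: cu_fun_wb.
- move=> u s ui us; apply: (@cu_fun_sup _ _ b (a \o u)); last exact: cu_fun_sup.
  by move=> m n mn; apply/cu_fun_le/ui.
Defined.

Definition cu_approx (S T : cuSemigroupType) (F : set S)
    (a b : cuMorphism S T) : Prop :=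
  forall x' x, F x' -> F x -> x' ≪ x -> a x' <= b x /\ b x' <= a x.

(* The class of objects of a subcategory is given as an injectively indexed
   family of Cu-semigroups. *)
Record cuSubcategory := CuSubcategory {
  cs_index : Type;
  cs_obj :> cs_index -> cuSemigroupType;
  cs_obj_inj : injective cs_obj;
  cs_hom : forall i j, set (cuMorphism (cs_obj i) (cs_obj j));
  cs_hom_id : forall i, cs_hom (cu_id (cs_obj i));
  cs_hom_comp : forall i j k
      (b : cuMorphism (cs_obj j) (cs_obj k)) (a : cuMorphism (cs_obj i) (cs_obj j)),
    cs_hom b -> cs_hom a -> cs_hom (cu_comp b a)
}.
Arguments cs_hom : clear implicits.

Record subsubcategory (C : cuSubcategory) := SubSubcategory {
  ss_obj : set (cs_index C);
  ss_hom : forall i j, set (cuMorphism (C i) (C j));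
  ss_hom_obj : forall i j (a : cuMorphism (C i) (C j)),
    ss_hom a -> ss_obj i /\ ss_obj j;
  ss_hom_sub : forall i j, @ss_hom i j `<=` cs_hom C i j;
  ss_hom_id : forall i, ss_obj i -> ss_hom (cu_id (C i));
  ss_hom_comp : forall i j k
      (b : cuMorphism (C j) (C k)) (a : cuMorphism (C i) (C j)),
    ss_hom b -> ss_hom a -> ss_hom (cu_comp b a)
}.
Arguments ss_hom {C} D i j _ : rename.

Definition ss_morphisms (C : cuSubcategory) (D : subsubcategory C) :
    set {i : cs_index C & {j : cs_index C & cuMorphism (C i) (C j)}} :=
  [set m | ss_hom D _ _ (projT2 (projT2 m))].

Definition JEP (C : cuSubcategory) : Prop :=
  forall i1 i2 : cs_index C, exists j : cs_index C,
    cs_hom C i1 j !=set0 /\ cs_hom C i2 j !=set0.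

Definition NAP (C : cuSubcategory) : Prop :=
  forall (i j1 j2 : cs_index C)
    (a1 : cuMorphism (C i) (C j1)) (a2 : cuMorphism (C i) (C j2)) (F : set (C i)),
  cs_hom C i j1 a1 -> cs_hom C i j2 a2 -> finite_set F ->
  exists (k : cs_index C)
    (b1 : cuMorphism (C j1) (C k)) (b2 : cuMorphism (C j2) (C k)),
    [/\ cs_hom C j1 k b1, cs_hom C j2 k b2
      & cu_approx F (cu_comp b1 a1) (cu_comp b2 a2)].

Definition SEP (C : cuSubcategory) : Prop :=
  exists D : subsubcategory C,
  [/\ forall i, ss_obj D i -> countably_based (C i),
      countable (ss_morphisms D),
      forall i, exists2 j, ss_obj D j & cs_hom C i j !=set0
    & forall (i j : cs_index C) (s : cuMorphism (C i) (C j)) (F : set (C i)),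
        ss_obj D i -> cs_hom C i j s -> finite_set F ->
        exists (k : cs_index C)
          (a : cuMorphism (C j) (C k)) (t : cuMorphism (C i) (C k)),
          [/\ ss_obj D k, cs_hom C j k a, ss_hom D i k t
            & cu_approx F (cu_comp a s) t] ].

Definition fraisse_category (C : cuSubcategory) : Prop :=
  [/\ JEP C, NAP C & SEP C].

Inductive nbar := Fin of nat | Inf.

Definition nbar_opt (x : nbar) := if x is Fin n then Some n else None.
Definition opt_nbar (x : option nat) := if x is Some n then Fin n else Inf.
Lemma nbar_optK : cancel nbar_opt opt_nbar. Proof. by case. Qed.
HB.instance Definition _ := Countable.copy nbar (can_type nbar_optK).

Definition nbar_add (x y : nbar) :=
  match x, y with Fin m, Fin n => Fin (m + n)%N | _, _ => Inf end.

Definition nbar_le (x y : nbar) :=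
  match x, y with
  | _, Inf => true
  | Inf, Fin _ => false
  | Fin m, Fin n => (m <= n)%N
  end.

Fact nbar_addA : associative nbar_add.
Proof. by move=> [m|] [n|] [p|] //=; rewrite addnA. Qed.
Fact nbar_addC : commutative nbar_add.
Proof. by move=> [m|] [n|] //=; rewrite addnC. Qed.
Fact nbar_add0 : left_id (Fin 0) nbar_add.
Proof. by case. Qed.
HB.instance Definition _ :=
  GRing.isNmodule.Build nbar nbar_addA nbar_addC nbar_add0.

Fact nbar_le_refl : reflexive nbar_le.
Proof. by case=> /=. Qed.
Fact nbar_le_anti : antisymmetric nbar_le.
Proof. by move=> [m|] [n|] //= h; congr Fin; apply/eqP; rewrite eqn_leq. Qed.
Fact nbar_le_trans : transitive nbar_le.
Proof. by move=> [m|] [n|] [p|] //=; apply: leq_trans. Qed.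
HB.instance Definition _ := Order.Le_isPOrder.Build cu_display nbar
  nbar_le_refl nbar_le_anti nbar_le_trans.

Definition nbar_pow (r : nat) := {ffun 'I_r -> nbar}.
HB.instance Definition _ r := GRing.Nmodule.on (nbar_pow r).

Definition nbar_pow_le r (x y : nbar_pow r) := [forall i, x i <= y i].

Fact nbar_pow_le_refl r : reflexive (@nbar_pow_le r).
Proof. by move=> x; apply/forallP. Qed.
Fact nbar_pow_le_anti r : antisymmetric (@nbar_pow_le r).
Proof.
move=> x y /andP[/forallP xy /forallP yx]; apply/ffunP => i.
by apply: le_anti; rewrite xy yx.
Qed.
Fact nbar_pow_le_trans r : transitive (@nbar_pow_le r).
Proof.
by move=> y x z /forallP xy /forallP yz; apply/forallP => i; apply: le_trans (yz i).
Qed.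
HB.instance Definition _ r := Order.Le_isPOrder.Build cu_display (nbar_pow r)
  (@nbar_pow_le_refl r) (@nbar_pow_le_anti r) (@nbar_pow_le_trans r).

Definition nbar_pow_one (r : nat) : nbar_pow r := [ffun => Fin 1].

Lemma nbar_powP r (x y : nbar_pow r) : reflect (forall i, x i <= y i) (x <= y).
Proof. exact: forallP. Qed.

Lemma nbar_ge0 (x : nbar) : 0 <= x. Proof. by case: x. Qed.

Lemma nbar_leD (x y z t : nbar) : x <= y -> z <= t -> x + z <= y + t.
Proof. by case: x y z t => [m|] [n|] [p|] [q|] //; apply: leq_add. Qed.

Lemma is_supP (S : porderType cu_display) (u : nat -> S) (s : S) :
  is_sup u s <->
  (forall n, u n <= s) /\ (forall t, (forall n, u n <= t) -> s <= t).
Proof.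
split=> -[us sl]; split.
- by move=> n; apply: us; exists n.
- by move=> t ut; apply: sl => _ [n _ <-].
- by move=> _ [n _ <-].
- by move=> t ut; apply: sl => n; apply: ut; exists n.
Qed.

Lemma is_sup_uniq (S : porderType cu_display) (u : nat -> S) (s t : S) :
  is_sup u s -> is_sup u t -> s = t.
Proof.
by move=> /is_supP[us sl] /is_supP[ut tl]; apply: le_anti; rewrite sl // tl.
Qed.

Definition nbar_limit (u : nat -> nbar) (s : nbar) :=
  (forall n, u n <= s) /\
  (if s is Fin k then exists n, u n = Fin k
   else forall k, exists n, Fin k <= u n).

Lemma nbar_limit_ex (u : nat -> nbar) : exists s, nbar_limit u s.
Proof.
have [unb|/existsNP[k /forallNP bd]] := pselect (forall k, exists n, Fin k <= u n).
  by exists Inf; split=> // n; case: (u n).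
have {bd} : forall n, u n <= Fin k.
  move=> n; have /negP := bd n; case: (u n) => [m|] //; rewrite /Order.le /=.
  by rewrite -ltnNge => /ltnW.
elim: k => [|k IH] bd.
  exists (Fin 0); split=> //; exists 0%N; have := bd 0%N.
  by case: (u 0%N) => [[|m]|].
have [[n un]|/forallNP nun] := pselect (exists n, u n = Fin k.+1).
  by exists (Fin k.+1); split=> //; exists n.
apply: IH => n; have := bd n; have := nun n; case: (u n) => [m|] // nm.
rewrite /Order.le /= leq_eqVlt => /orP[/eqP mk|//].
by case: nm; rewrite mk.
Qed.

Lemma nbar_limit_sup u s : nbar_limit u s -> is_sup u s.
Proof.
move=> [us lim]; apply/is_supP; split=> // t ut.
case: s lim us => [k [n <-] //|unb _].
case: t ut => [k|] // ut; have [n ukn] := unb k.+1.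
by have := le_trans ukn (ut n); rewrite /Order.le /= ltnn.
Qed.

Lemma nbar_pow_sup r (u : nat -> nbar_pow r) (s : nbar_pow r) :
  is_sup u s <-> forall i, nbar_limit (fun n => u n i) (s i).
Proof.
have sufsup (t : nbar_pow r) : (forall i, nbar_limit (fun n => u n i) (t i)) -> is_sup u t.
  move=> lim; apply/is_supP; split=> [n|x ux].
    by apply/nbar_powP => i; apply: (lim i).1.
  apply/nbar_powP => i; have /is_supP[_] := nbar_limit_sup (lim i).
  by apply=> n; apply/nbar_powP.
split=> [us|]; last exact: sufsup.
have [t tP] := choice (fun i => nbar_limit_ex (fun n => u n i)).
have ut : is_sup u [ffun i => t i] by apply: sufsup => i; rewrite ffunE.
by rewrite (is_sup_uniq us ut) => i; rewrite ffunE.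
Qed.

Definition nbar_trunc n (x : nbar) := if x is Fin m then Fin (minn n m) else Fin n.

Lemma nbar_trunc_limit (x : nbar) : nbar_limit (nbar_trunc^~ x) x.
Proof.
case: x => [m|]; split=> //=.
- by move=> n; rewrite /Order.le /= geq_minr.
- by exists m; rewrite minnn.
- by move=> k; exists k.
Qed.

Lemma nbar_pow_wb r (x y : nbar_pow r) :
  x ≪ y <-> x <= y /\ forall i, x i != Inf.
Proof.
split=> [xy|[xy fx] z s zi /nbar_pow_sup zs ys].
  pose z n : nbar_pow r := [ffun i => nbar_trunc n (y i)].
  have [||n xn] := xy z y _ _ (lexx _).
  - move=> m n mn; apply/nbar_powP => i; rewrite !ffunE.
    case: (y i) => [k|] //=; rewrite /Order.le /= leq_min geq_minr andbT.
    exact: leq_trans (geq_minl _ _) mn.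
  - apply/nbar_pow_sup => i; under eq_fun do rewrite ffunE.
    exact: nbar_trunc_limit.
  split=> [|i]; first apply: le_trans xn _; last have /nbar_powP/(_ i) := xn.
    by apply/nbar_powP => i; rewrite ffunE; apply: (nbar_trunc_limit _).1.
  by rewrite ffunE; case: (x i) (y i) => [m|] [k|].
have /choice[N NP] : forall i, exists n, x i <= z n i.
  move=> i; have [_] := zs i; have /nbar_powP/(_ i) := le_trans xy ys.
  case: (s i) => [k xk [n zn]|_ unb]; first by exists n; rewrite zn.
  by case: (x i) (fx i) => // k _; apply: unb.
exists (\max_i N i)%N; apply/nbar_powP => i; apply: le_trans (NP i) _.
by apply/nbar_powP/zi/leq_bigmax.
Qed.

Section NbarPowCu.
Variable r : nat.
Implicit Types x y z : nbar_pow r.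

Fact nbar_pow_ge0 x : 0 <= x.
Proof. by apply/nbar_powP => i; rewrite ffunE nbar_ge0. Qed.

Fact nbar_pow_leD2r x y z : x <= y -> x + z <= y + z.
Proof.
by move=> /nbar_powP xy; apply/nbar_powP => i; rewrite !ffunE nbar_leD.
Qed.

Fact nbar_pow_O1 (u : nat -> nbar_pow r) : increasing u -> exists s, is_sup u s.
Proof.
move=> _; have [t tP] := choice (fun i => nbar_limit_ex (fun n => u n i)).
by exists [ffun i => t i]; apply/nbar_pow_sup => i; rewrite ffunE.
Qed.

Fact nbar_pow_O2 x : exists u : nat -> nbar_pow r,
  (forall n, u n ≪ u n.+1) /\ is_sup u x.
Proof.
exists (fun n => [ffun i => nbar_trunc n (x i)]); split=> [n|].
  apply/nbar_pow_wb; split=> [|i]; last by rewrite ffunE; case: (x i).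
  apply/nbar_powP => i; rewrite !ffunE; case: (x i) => [k|] /=.
    by rewrite /Order.le /= leq_min geq_minr andbT (leq_trans (geq_minl _ _)).
  exact: leqnSn.
apply/nbar_pow_sup => i; under eq_fun do rewrite ffunE.
exact: nbar_trunc_limit.
Qed.

Fact nbar_pow_O3 x' x y' y : x' ≪ x -> y' ≪ y -> x' + y' ≪ x + y.
Proof.
move=> /nbar_pow_wb[/nbar_powP xx fx] /nbar_pow_wb[/nbar_powP yy fy].
apply/nbar_pow_wb; split=> [|i].
  by apply/nbar_powP => i; rewrite !ffunE nbar_leD.
by rewrite ffunE; case: (x' i) (y' i) (fx i) (fy i) => [m|] [n|].
Qed.

Fact nbar_pow_O4 (u v : nat -> nbar_pow r) (s t : nbar_pow r) :
  increasing u -> increasing v -> is_sup u s -> is_sup v t ->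
  is_sup (fun n => u n + v n) (s + t).
Proof.
move=> ui vi /nbar_pow_sup us /nbar_pow_sup vt; apply/nbar_pow_sup => i.
under eq_fun do rewrite ffunE; rewrite ffunE.
have [usi limu] := us i; have [vti limv] := vt i.
split=> [n|]; first exact: nbar_leD.
case: (s i) (t i) limu limv usi vti => [k|] [l|].
- move=> [m um] [n vn] usi vti; exists (maxn m n); apply: le_anti.
  apply/andP; split; first exact: (nbar_leD (usi _) (vti _)).
  rewrite -[Fin _]/(Fin k + Fin l) -um -vn; apply: nbar_leD.
    by apply/nbar_powP/ui/leq_maxl.
  by apply/nbar_powP/vi/leq_maxr.
- move=> _ unb _ _.
  change (forall j, exists n, Fin j <= u n i + v n i) => j.
  have [n nj] := unb j; exists n.
  by rewrite -[Fin j]add0r nbar_leD ?nbar_ge0.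
- move=> unb _ _ _.
  change (forall j, exists n, Fin j <= u n i + v n i) => j.
  have [n nj] := unb j; exists n.
  by rewrite -[Fin j]addr0 nbar_leD ?nbar_ge0.
- move=> unb _ _ _.
  change (forall j, exists n, Fin j <= u n i + v n i) => j.
  have [n nj] := unb j; exists n.
  by rewrite -[Fin j]addr0 nbar_leD ?nbar_ge0.
Qed.

HB.instance Definition _ := isCuSemigroup.Build (nbar_pow r)
  nbar_pow_ge0 nbar_pow_leD2r nbar_pow_O1 nbar_pow_O2 nbar_pow_O3 nbar_pow_O4.

End NbarPowCu.

Definition simplicial (r : nat) : cuSemigroupType := nbar_pow r.

Lemma simplicial_inj : injective simplicial.
Proof.
pose width (S : cuSemigroupType) n := exists f : 'I_n -> S,
  (forall i, f i != 0) /\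
  (forall i j x, i != j -> x <= f i -> x <= f j -> x = 0).
have widthr r : width (simplicial r) r.
  exists (fun i => [ffun j => if j == i then Fin 1 else 0] : nbar_pow r).
  split=> [i|i j x ij /nbar_powP xi /nbar_powP xj].
    by apply/eqP => /ffunP/(_ i); rewrite !ffunE eqxx.
  apply/ffunP => k; rewrite ffunE; apply: le_anti; rewrite nbar_ge0 andbT.
  have [ki|ki] := eqVneq k i; last by have := xi k; rewrite ffunE (negPf ki).
  by have := xj k; rewrite ffunE ki (negPf ij).
have width_le r n : width (simplicial r) n -> (n <= r)%N.
  move=> [f [f0 fd]].
  have /choice[g gP] : forall i, exists k, (f i : nbar_pow r) k != 0.
    move=> i; apply: contrapT => /forallNP fi0; case/eqP: (f0 i).
    by apply/ffunP => k; have /negP := fi0 k; rewrite negbK ffunE => /eqP.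
  have ginj : injective g.
    move=> i j gij; apply: contrapT => /eqP ij.
    pose x : nbar_pow r := [ffun k => if k == g i then Fin 1 else 0].
    have xle l : g l = g i -> x <= (f l : nbar_pow r).
      move=> gl; apply/nbar_powP => k; rewrite ffunE.
      have [->|_] := eqVneq; last exact: nbar_ge0.
      by have := gP l; rewrite gl; case: ((f l : nbar_pow r) _) => [[|m]|].
    have /ffunP/(_ (g i)) := fd i j x ij (xle i erefl) (xle j (esym gij)).
    by rewrite !ffunE eqxx.
  by have := leq_card g ginj; rewrite !card_ord.
move=> r t rt; apply/eqP; rewrite eqn_leq.
apply/andP; split; apply: width_le; first by rewrite -rt.
by rewrite rt.
Qed.

Definition K_index := {r : nat | (1 <= r)%N}.

Definition K_obj (i : K_index) : cuSemigroupType := simplicial (val i).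

Definition K_hom (i j : K_index) : set (cuMorphism (K_obj i) (K_obj j)) :=
  [set a | order_embedding a /\ a (nbar_pow_one (val i)) = nbar_pow_one (val j)].

Fact K_obj_inj : injective K_obj.
Proof. by move=> i j /simplicial_inj/val_inj. Qed.

Fact K_hom_id i : K_hom (cu_id (K_obj i)).
Proof. by split. Qed.

Fact K_hom_comp i j k
    (b : cuMorphism (K_obj j) (K_obj k)) (a : cuMorphism (K_obj i) (K_obj j)) :
  K_hom b -> K_hom a -> K_hom (cu_comp b a).
Proof.
move=> [be b1] [ae a1]; split=> [x y /be/ae //|].
by rewrite /= a1.
Qed.

Definition K_cantor : cuSubcategory :=
  CuSubcategory K_obj_inj K_hom_id K_hom_comp.

(* Main.v *)
From mathcomp Require Import all_boot all_order ssralg.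
From mathcomp Require Import boolp classical_sets functions cardinality.
Require Import Defs.

(** A morphism of K_cantor from [N^r] to [N^t] is precomposition with a
    surjection ['I_t -> 'I_r]: the images of the basis vectors [e_i] add up to
    [1], so every coordinate [j] of the target sees exactly one [e_i].  Hence
    K_cantor is the opposite of the category of nonempty finite sets and
    surjections, in which products give (JEP), fibre products give strict
    amalgamation, and (SEP) holds with the whole category as subcategory. *)

Set Implicit Arguments.
Unset Strict Implicit.
Unset Printing Implicit Defensive.

Import Order.TTheory GRing.Theory.

Local Open Scope classical_set_scope.
Local Open Scope order_scope.
Local Open Scope ring_scope.

(** The laws of a morphism are propositions, so proof irrelevance leaves only the underlying
    functions to compare. *)
Lemma cuMorphismP (S T : cuSemigroupType) (a b : cuMorphism S T) :
  (forall x, a x = b x) -> a = b.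
Proof.
case: a b => [f f1 f2 f3 f4] [g g1 g2 g3 g4] /= /funext fg.
by case: g / fg g1 g2 g3 g4 => *; congr CuMorphism; apply: Prop_irrelevance.
Qed.

Lemma way_below_le (S : cuSemigroupType) (x y : S) : x ≪ y -> x <= y.
Proof.
have ysup : is_sup (fun=> y) y by apply/is_supP; split=> // t /(_ 0%N).
have yincr : increasing (fun=> y) by [].
by move=> /(_ _ _ yincr ysup (lexx y))[].
Qed.

(** The squares built for (NAP) and (SEP) commute strictly; monotonicity then gives the comparison,
    as [≪] implies [<=]. *)
Lemma cu_approx_eq (S T : cuSemigroupType) (F : set S) (a b : cuMorphism S T) :
  (forall x, a x = b x) -> cu_approx F a b.
Proof.
by move=> ab x' x _ _ /way_below_le x'x; split; rewrite ab; apply: cu_fun_le.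
Qed.

Section Pullback.
Variables (r t : nat) (f : 'I_t -> 'I_r).

Definition pull_fun (x : simplicial r) : simplicial t :=
  [ffun j => (x : nbar_pow r) (f j)] : nbar_pow t.

Definition pull : cuMorphism (simplicial r) (simplicial t).
Proof.
exists pull_fun.
- by split=> [|x y]; apply/ffunP => j; rewrite !ffunE.
- by move=> x y /nbar_powP xy; apply/nbar_powP => j; rewrite !ffunE.
- move=> x y /nbar_pow_wb[/nbar_powP xy xfin]; apply/nbar_pow_wb.
  by split=> [|j]; [apply/nbar_powP => j|]; rewrite !ffunE.
- move=> u s _ /nbar_pow_sup us; apply/nbar_pow_sup => j.
  by under eq_fun do rewrite ffunE; rewrite ffunE.
Defined.

Lemma pullE (x : nbar_pow r) j : (pull x : nbar_pow t) j = x (f j).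
Proof. by rewrite ffunE. Qed.

Lemma pull_one : pull (nbar_pow_one r) = nbar_pow_one t.
Proof. by apply/ffunP => j; rewrite !ffunE. Qed.

Lemma pull_embedding : (forall i, exists j, f j = i) -> order_embedding pull.
Proof.
move=> fsurj x y /nbar_powP xy; apply/nbar_powP => i.
by have [j <-] := fsurj i; have := xy j; rewrite !ffunE.
Qed.

End Pullback.

Section UnitalMorphism.
Variables (r t : nat) (a : cuMorphism (simplicial r) (simplicial t)).
Hypothesis a_one : a (nbar_pow_one r) = nbar_pow_one t.

Let ev (j : 'I_t) (x : nbar_pow r) : nbar := (a x : nbar_pow t) j.

Let evD j (x y : nbar_pow r) : ev j (x + y) = ev j x + ev j y.
Proof. by rewrite /ev (cu_fun_nmod a).2 ffunE. Qed.

Let ev0 j : ev j 0 = 0.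
Proof. by rewrite /ev (cu_fun_nmod a).1 ffunE. Qed.

Let evMn j x n : ev j (x *+ n) = ev j x *+ n.
Proof. by elim: n => [|n IH]; rewrite ?mulr0n ?ev0 // !mulrS evD IH. Qed.

Let ev_le j (x y : nbar_pow r) : x <= y -> ev j x <= ev j y.
Proof. by move=> xy; have /nbar_powP/(_ j) := cu_fun_le a xy. Qed.

Let basis (i : 'I_r) : nbar_pow r := [ffun k => if k == i then Fin 1 else 0].
Let cobasis (i : 'I_r) : nbar_pow r := [ffun k => if k == i then 0 else Fin 1].

Let natmul_Fin1 n : Fin 1 *+ n = Fin n.
Proof. by elim: n => // n IH; rewrite mulrS IH. Qed.

Let ffun_natmul (x : nbar_pow r) n i : (x *+ n) i = x i *+ n.
Proof. by elim: n => [|n IH]; rewrite ?mulr0n ?mulrS ffunE // IH. Qed.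

(** By monotonicity each [ev j (basis i)] is at most 1. If none were 1, all would vanish, and so
    would their sum, which is 1. *)
Let ev_basis j : exists i, ev j (basis i) = Fin 1.
Proof.
apply: contrapT => /forallNP no_i.
have evb0 i : ev j (basis i) = 0.
  have : ev j (basis i) <= ev j (nbar_pow_one r).
    apply: ev_le; apply/nbar_powP => k; rewrite !ffunE.
    by case: ifP => // _; apply: nbar_ge0.
  rewrite {2}/ev a_one ffunE; have := no_i i.
  by case: (ev j (basis i)) => [[|[|n]]|].
suff : ev j (nbar_pow_one r) = 0 by rewrite /ev a_one ffunE.
have -> : nbar_pow_one r = \sum_i basis i.
  apply/ffunP => k; rewrite sum_ffunE ffunE (bigD1 k) //= ffunE eqxx.
  rewrite big1 ?addr0 // => i ik; rewrite ffunE eq_sym.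
  by rewrite (negPf ik).
by rewrite (big_morph (ev j) (evD j) (ev0 j)) big1.
Qed.

(** In [nbar], [1 + y = 1] forces [y = 0]. *)
Let ev_cobasis j i : ev j (basis i) = Fin 1 -> ev j (cobasis i) = 0.
Proof.
move=> evb; have : ev j (basis i + cobasis i) = Fin 1.
  rewrite (_ : basis i + cobasis i = nbar_pow_one r) ?/ev ?a_one ?ffunE //.
  by apply/ffunP => k; rewrite !ffunE; case: ifP.
rewrite evD evb; case: (ev j (cobasis i)) => [n|] //.
by case: n.
Qed.

(* If [e] is the indicator of the complement of [i], then [oo * e] is the
   supremum of the multiples of [e], all of which are killed at [j]. *)
Let ev_infty_cobasis j i : ev j (basis i) = Fin 1 ->
  ev j [ffun k => if k == i then 0 else Inf] = 0.
Proof.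
move=> /ev_cobasis evc.
pose u n : nbar_pow r := cobasis i *+ n.
set c := (X in ev j X).
have uE n k : u n k = if k == i then 0 else Fin n.
  by rewrite ffun_natmul ffunE; case: ifP; rewrite ?mul0rn ?natmul_Fin1.
have u_incr : increasing u.
  move=> m n mn; apply/nbar_powP => k; rewrite !uE.
  by case: ifP.
have u_sup : is_sup u c.
  apply/nbar_pow_sup => k; under eq_fun do rewrite uE.
  rewrite ffunE; case: ifP => _; split=> //.
  by move=> n; exists n.
have /nbar_pow_sup/(_ j)[_] := cu_fun_sup a u_incr u_sup.
have evu n : (a (u n) : nbar_pow t) j = 0.
  by rewrite -/(ev j (u n)) evMn evc mul0rn.
(* A finite supremum is attained, hence is 0; an infinite one would need a term that is at least
   1. *)
by rewrite -/(ev j c); case: (ev j c) => [k [n]|/(_ 1%N)[n]]; rewrite evu.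
Qed.

Lemma unital_morphism_coord j :
  exists i, forall x : nbar_pow r, (a x : nbar_pow t) j = x i.
Proof.
have [i evb] := ev_basis j; exists i => x; rewrite -/(ev j x).
apply: le_anti; apply/andP; split.
  case xi: (x i) => [m|]; last by case: (ev j x).
  (* [y] agrees with [x] at [i] and is infinite elsewhere, where it contributes nothing to
     [ev j]. *)
  pose y : nbar_pow r := basis i *+ m + [ffun k => if k == i then 0 else Inf].
  have : ev j x <= ev j y.
    apply: ev_le; apply/nbar_powP => k; rewrite ffunE ffun_natmul !ffunE.
    have [->|_] := eqVneq k i; first by rewrite xi addr0 natmul_Fin1.
    by rewrite mul0rn add0r; case: (x k).
  by rewrite /y evD evMn evb ev_infty_cobasis // addr0 natmul_Fin1.
(* Finite lower bounds, from [basis i *+ m <= x], also settle the case where [x i] is infinite. *)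
have lb m : Fin m <= x i -> Fin m <= ev j x.
  move=> mx; rewrite -natmul_Fin1 -evb -evMn; apply: ev_le.
  apply/nbar_powP => k; rewrite ffun_natmul ffunE.
  have [->|_] := eqVneq k i; first by rewrite natmul_Fin1.
  by rewrite mul0rn nbar_ge0.
case: (x i) lb => [m|] lb; first exact: lb.
case: (ev j x) lb => // n /(_ n.+1 isT).
by rewrite /Order.le /= ltnn.
Qed.

Lemma unital_morphism_pull : exists f, a = pull f.
Proof.
have [f fP] := choice unital_morphism_coord; exists f.
by apply: cuMorphismP => x; apply/ffunP => j; rewrite pullE.
Qed.

End UnitalMorphism.

(** If [f] missed [i], then [pull f] would send the basis vector [e] at [i] to 0, forcing
    [e <= 0]. *)
Lemma pull_embedding_surj r t (f : 'I_t -> 'I_r) :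
  order_embedding (pull f) -> forall i, exists j, f j = i.
Proof.
move=> fe i; apply: contrapT => /forallNP nfi.
pose e : nbar_pow r := [ffun k => if k == i then Fin 1 else 0].
suff /fe /nbar_powP/(_ i) : pull f e <= pull f 0 by rewrite !ffunE eqxx.
apply/nbar_powP => j; rewrite !pullE !ffunE.
by case: eqP => // /nfi.
Qed.

Lemma K_homP (i j : K_index) (a : cuMorphism (K_obj i) (K_obj j)) :
  K_hom a <->
  exists2 f : 'I_(val j) -> 'I_(val i), a = pull f & forall k, exists l, f l = k.
Proof.
split=> [[ae a1]|[f -> fsurj]].
  have [f af] := unital_morphism_pull a1.
  by exists f => //; apply: pull_embedding_surj; rewrite -af.
by split; [apply: pull_embedding|apply: pull_one].
Qed.

(** Objects are indexed by numbers, so a finite set [T] enters through its enumeration by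
    ['I_#|T|]. *)
Lemma K_pull (i : K_index) (T : finType) (T0 : (0 < #|T|)%N) (p : T -> 'I_(val i)) :
  (forall k, exists x, p x = k) ->
  @K_hom i (exist _ #|T| T0) (pull (fun l : 'I_#|T| => p (enum_val l))).
Proof.
move=> psurj; apply/K_homP; exists (fun l : 'I_#|T| => p (enum_val l)) => // k.
by have [x <-] := psurj k; exists (enum_rank x); rewrite enum_rankK.
Qed.

Lemma K_JEP : JEP K_cantor.
Proof.
move=> [r r0] [t t0]; pose T : finType := ('I_r * 'I_t)%type.
have T0 : (0 < #|T|)%N by rewrite card_prod !card_ord muln_gt0 r0.
exists (exist _ #|T| T0); split.
  exists (pull (fun l : 'I_#|T| => (enum_val l).1)).
  by apply: (@K_pull (exist _ r r0)) => k; exists (k, Ordinal t0).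
exists (pull (fun l : 'I_#|T| => (enum_val l).2)).
by apply: (@K_pull (exist _ t t0)) => k; exists (Ordinal r0, k).
Qed.

Lemma K_NAP : NAP K_cantor.
Proof.
move=> i j1 j2 a1 a2 F /K_homP[f1 -> f1surj] /K_homP[f2 -> f2surj] _.
(* The fibre product of [f1] and [f2]: each projection is onto because the opposite map is. *)
pose T : finType := {p : 'I_(val j1) * 'I_(val j2) | f1 p.1 == f2 p.2}.
have psurj1 k : exists x : T, (val x).1 = k.
  have [l fl] := f2surj (f1 k).
  have kl : f1 (k, l).1 == f2 (k, l).2 by rewrite fl.
  by exists (exist _ (k, l) kl).
have psurj2 k : exists x : T, (val x).2 = k.
  have [l fl] := f1surj (f2 k).
  have kl : f1 (l, k).1 == f2 (l, k).2 by rewrite fl.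
  by exists (exist _ (l, k) kl).
have T0 : (0 < #|T|)%N.
  have [x _] := psurj1 (Ordinal (valP j1)).
  by apply/card_gt0P; exists x.
exists (exist _ #|T| T0).
exists (pull (fun l : 'I_#|T| => (val (enum_val l)).1)).
exists (pull (fun l : 'I_#|T| => (val (enum_val l)).2)).
split; [exact: (K_pull T0 psurj1)|exact: (K_pull T0 psurj2)|].
apply: cu_approx_eq => x; apply/ffunP => l /=.
by rewrite !ffunE (eqP (valP (enum_val l))).
Qed.

Lemma simplicial_countably_based r : countably_based (simplicial r).
Proof.
exists setT => [|x]; first exact: (@countableP (nbar_pow r)).
by have [u [uwb us]] := cu_O2 x; exists u.
Qed.

Definition K_full : subsubcategory K_cantor :=
  @SubSubcategory K_cantor setT (cs_hom K_cantor) (fun _ _ _ _ => conj I I)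
    (fun _ _ => @subset_refl _ _) (fun i _ => cs_hom_id (c := K_cantor) i)
    (@cs_hom_comp K_cantor).

(** Every morphism is a pullback, so the morphisms lie in the image of the countable type [P] of
    maps between finite ordinals. *)
Lemma K_full_countable : countable (ss_morphisms K_full).
Proof.
pose P := {i : K_index & {j : K_index & {ffun 'I_(val j) -> 'I_(val i)}}}.
pose M := {i : K_index & {j : K_index & cuMorphism (K_obj i) (K_obj j)}}.
pose h (s : P) : M :=
  existT _ (tag s) (existT _ (tag (tagged s)) (pull (tagged (tagged s)))).
apply: (@sub_countable _ _ _ (h @` setT)).
  apply: subset_card_le => -[i [j a]] /K_homP[f /= -> _].
  exists (existT _ i (existT _ j (finfun f))) => //; rewrite /h /=.
  suff -> : pull (finfun f) = pull f by [].
  by congr pull; apply/funext => k; rewrite ffunE.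
apply: (card_le_trans (card_image_le _ _)).
exact: countableP.
Qed.

Lemma K_SEP : SEP K_cantor.
Proof.
exists K_full; split.
- by move=> i _; apply: simplicial_countably_based.
- exact: K_full_countable.
- by move=> i; exists i => //; exists (cu_id _); apply: K_hom_id.
(* Since [K_full] contains every morphism, [s] itself serves as the approximating morphism. *)
- move=> i j s F _ sK _; exists j, (cu_id _), s; split=> //; first exact: K_hom_id.
  exact: cu_approx_eq.
Qed.

Theorem theorem4p28 : fraisse_category K_cantor.
Proof. by split; [apply: K_JEP|apply: K_NAP|apply: K_SEP]. Qed.
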